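(* For $u,v,n \in \mathbb{N}$, let $D(u,v,n)$ denote the number of admissible coloured partitions (as defined in the context) whose size is $n$ and whose weights are $u$ and $v$. Then, as formal power series in $a,b,q$, \begin{equation*} \sum_{u,v,n \in \mathbb{N}} D(u,v,n)\,a^u b^v q^n = \prod_{n\geq 1} \left(1+aq^n\right)\left(1+bq^n\right). \end{equation*}
   Context: Coloured integers: every positive integer $k$ occurs in the three colours $a$, $b$, $ab$ (written $k_a$, $k_b$, $k_{ab}$). In addition, odd positive integers occur in the colours $a^2$ and $b^2$: $k_{b^2}$ for every odd $k\ge 1$ and $k_{a^2}$ for every odd $k \geq 3$. The integer value of $k_x$ is $k$ and its colour is $x$. These coloured integers are totally ordered by $$1_{ab} < 1_a < 1_{b^2} <1_{b} <2_{ab} < 2_a <3_{a^2} < 2_{b} <3_{ab} < 3_a < 3_{b^2} <3_b <4_{ab}<4_a<5_{a^2}<4_b<5_{ab}<\cdots,$$ that is, for every odd $m\ge1$: $m_{ab}<m_a<m_{b^2}<m_b<(m+1)_{ab}<(m+1)_a<(m+2)_{a^2}<(m+1)_b<(m+2)_{ab}$. Difference conditions: for a coloured integer $\lambda$ (the ''upper'' part) of colour $x$ and a coloured integer $\mu$ (the ''lower'' part) of colour $y$, a minimal difference $A(\lambda,\mu)$ is defined as follows, where the row is determined by the colour and the parity of the integer value of $\lambda$, and the entries are listed for $y = a, b, ab, a^2, b^2$ in this order: - $\lambda$ of colour $a$, odd: $2,2,1,2,2$; - $\lambda$ of colour $b^2$: $2,3,2,2,4$; - $\lambda$ of colour $b$,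 odd: $1,2,1,2,2$; - $\lambda$ of colour $ab$, even: $2,2,2,3,3$; - $\lambda$ of colour $a$, even: $2,2,2,3,3$; - $\lambda$ of colour $a^2$: $3,3,3,4,4$; - $\lambda$ of colour $b$, even: $1,2,1,1,3$; - $\lambda$ of colour $ab$, odd: $2,3,2,2,3$. An admissible coloured partition is a finite (possibly empty) sequence $\lambda_1,\dots,\lambda_s$ of coloured integers, none of which equals $1_{ab}$ or $1_{b^2}$, such that for every $1\le i<s$ the integer values satisfy $\lambda_i-\lambda_{i+1}\ge A(\lambda_i,\lambda_{i+1})$. Its size is the sum of the integer values of its parts. Its weight $u$ is the number of parts of colour $a$ or $ab$ plus twice the number of parts of colour $a^2$; its weight $v$ is the number of parts of colour $b$ or $ab$ plus twice the number of parts of colour $b^2$. *)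

(* Defs.v *)
From HB Require Import structures.
From mathcomp Require Import all_boot all_order all_algebra.
From mathcomp Require Import mpoly.
Set Implicit Arguments.
Unset Strict Implicit.
Unset Printing Implicit Defensive.
Import GRing.Theory.

Inductive colour := Ca | Cb | Cab | Ca2 | Cb2.

Definition colour_eqb (x y : colour) : bool :=
  match x, y with
  | Ca, Ca | Cb, Cb | Cab, Cab | Ca2, Ca2 | Cb2, Cb2 => true
  | _, _ => false
  end.

Lemma colour_eqP : Equality.axiom colour_eqb.
Proof. by case; case; constructor. Qed.

HB.instance Definition _ := hasDecEq.Build colour colour_eqP.

Definition cint := (nat * colour)%type.

Definition cint_exists (l : cint) : bool :=
  let: (k, x) := l in
  match x with
  | Ca | Cb | Cab => 0 < k
  | Cb2 => odd k
  | Ca2 => odd k && (3 <= k)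
  end.

Definition part_ok (l : cint) : bool :=
  cint_exists l && (l != (1, Cab)) && (l != (1, Cb2)).

Definition row (y : colour) (ea eb eab ea2 eb2 : nat) : nat :=
  match y with Ca => ea | Cb => eb | Cab => eab | Ca2 => ea2 | Cb2 => eb2 end.

Definition Adiff (l : cint) (y : colour) : nat :=
  let: (k, x) := l in
  match x with
  | Ca  => if odd k then row y 2 2 1 2 2 else row y 2 2 2 3 3
  | Cb2 => row y 2 3 2 2 4
  | Cb  => if odd k then row y 1 2 1 2 2 else row y 1 2 1 1 3
  | Cab => if odd k then row y 2 3 2 2 3 else row y 2 2 2 3 3
  | Ca2 => row y 3 3 3 4 4
  end.

(* lambda_i - lambda_{i+1} >= A(lambda_i, lambda_{i+1}) (as integers). *)
Definition diff_ok (l m : cint) : bool := m.1 + Adiff l m.2 <= l.1.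

Definition admissible (s : seq cint) : bool :=
  all part_ok s && sorted diff_ok s.

Definition psize (s : seq cint) : nat := sumn (map fst s).

Definition weight_u (s : seq cint) : nat :=
  count (fun l => (l.2 == Ca) || (l.2 == Cab)) s + 2 * count (fun l => l.2 == Ca2) s.

Definition weight_v (s : seq cint) : nat :=
  count (fun l => (l.2 == Cb) || (l.2 == Cab)) s + 2 * count (fun l => l.2 == Cb2) s.

Fixpoint seqs_upto (T : Type) (xs : seq T) (len : nat) : seq (seq T) :=
  if len is l.+1 then [::] :: [seq x :: s | x <- xs, s <- seqs_upto xs l]
  else [:: [::]].

Definition cints_upto (n : nat) : seq cint :=
  [seq (k, x) | k <- iota 1 n, x <- [:: Ca; Cb; Cab; Ca2; Cb2]].

(* D(u,v,n): number of admissible coloured partitions of size n with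
   weights u and v.  Such a partition has at most n parts, each of value
   in 1..n, so it occurs in the (duplicate-free) enumeration below. *)
Definition D (u v n : nat) : nat :=
  count (fun s => [&& admissible s, psize s == n, weight_u s == u & weight_v s == v])
        (undup (seqs_upto (cints_upto n) n)).

(* Monomial a^u b^v q^n in the variables X_0 = a, X_1 = b, X_2 = q. *)
Definition mono (u v n : nat) : 'X_{1..3} := [multinom [tuple u; v; n]].

Definition prodN (N : nat) : {mpoly int[3]} :=
  (\prod_(1 <= k < N.+1)
     ((1 + 'X_(0 : 'I_3) * 'X_(2 : 'I_3) ^+ k) * (1 + 'X_(1 : 'I_3) * 'X_(2 : 'I_3) ^+ k)))%R.

(* Main.v *)
(** Let [G_x] be the generating function of the admissible sequences whose
    first part is at most [x] in the given order.  Splitting according to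
    whether the first part is [x] gives linear recurrences along the order,
    and these yield, for every [k],
      [G_{(k+1)_ab}(a, b) = (1 + a q) G_{k_a}(b, a q)].
    Letting [k] tend to infinity, [G(a, b) = (1 + a q) G(b, a q)], hence
    [G(a, b) = (1 + a q) (1 + b q) G(a q, b q)], and iterating produces the
    infinite product.  The limit is taken as a congruence modulo a power of
    [q] between the polynomials [G_x]. *)

Require Import Defs.
From mathcomp Require Import all_boot all_order all_algebra.
From mathcomp Require Import mpoly zify ring.

Set Implicit Arguments.
Unset Strict Implicit.
Unset Printing Implicit Defensive.

Import GRing.Theory.

(** * Enumerating admissible sequences by their first part *)

(* The order on coloured integers, encoded by its order embedding in [nat]. *)
Definition rank (l : cint) : nat :=
  match l.2 with
  | Cab => 4 * l.1
  | Ca => 4 * l.1 + 1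
  | Cb2 => 4 * l.1 + 2
  | Cb => 4 * l.1 + 3
  | Ca2 => 4 * l.1 - 2
  end.

Definition head_sat (h : pred cint) (s : seq cint) : bool :=
  if s is x :: _ then h x else true.

Definition enumerates (h : pred cint) (L : seq (seq cint)) : Prop :=
  uniq L /\ forall s, (s \in L) = admissible s && head_sat h s.

Definition extend (x : cint) (L1 L2 : seq (seq cint)) := L1 ++ map (cons x) L2.

Lemma admissible_cons x s :
  admissible (x :: s) = [&& part_ok x, admissible s & head_sat (diff_ok x) s].
Proof.
rewrite /admissible /=; case: s => [|y s] /=; first by rewrite !andbT.
by rewrite -!andbA; do !bool_congr.
Qed.

Lemma enumerates_nil : enumerates pred0 [:: [::]].
Proof. by split=> // -[|x s]; rewrite inE //= andbF. Qed.

(** A sequence with head [x] is [x] followed by an admissible sequence whose head may follow [x]; it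
    is not in [L1] because [h1] rejects [x]. The predicates are compared on genuine parts only,
    since they may differ elsewhere, for instance at colour [Cb2] with an even value. *)
Lemma enumerates_extend x h1 h2 h L1 L2 :
    enumerates h1 L1 -> enumerates h2 L2 -> part_ok x -> ~~ h1 x ->
    (forall y, part_ok y -> h2 y = diff_ok x y) ->
    (forall y, part_ok y -> h y = h1 y || (y == x)) ->
  enumerates h (extend x L1 L2).
Proof.
move=> [u1 m1] [u2 m2] okx nh1x h2E hE; split.
  rewrite cat_uniq u1 map_inj_uniq ?u2 ?andbT => [|s t []//].
  apply/hasPn => _ /mapP[s _ ->]; rewrite m1 /=.
  by rewrite (negbTE nh1x) andbF.
move=> s; rewrite mem_cat m1; case: s => [|y s].
  have /negbTE -> : [::] \notin map (cons x) L2 by apply/mapP => -[].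
  by rewrite orbF.
have -> : (y :: s \in map (cons x) L2) = (y == x) && (s \in L2).
  apply/mapP/andP => [[t tL [-> ->]]|[/eqP -> sL]]; last by exists s.
  by rewrite eqxx.
rewrite m2 admissible_cons /=; case oky: (part_ok y); last first.
  by case: eqP oky => //= ->; rewrite okx.
rewrite hE //=; case: eqP => [->|_]; rewrite ?orbF //=.
rewrite (negbTE nh1x) andbF andbT /=; case ads: (admissible s) => //=.
case: s ads => //= z s; rewrite admissible_cons => /and3P[okz _ _].
exact: h2E.
Qed.

(** * The enumerating lists, built from one even value to the next *)

(* Below, [l] is even, and [Z], [M] and [R] stand for the lists of admissible
   sequences whose head is at most [l_ab], at most [(l-1)_a], and at most
   [(l-2)_b] but different from [(l-1)_(a^2)].  The exclusion is needed because
   some rows of the difference table allow [(l-2)_b] as the next part but not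
   the smaller [(l-1)_(a^2)]. *)
Definition upto_a l (Z R : seq (seq cint)) := extend (l, Ca) Z R.
Definition upto_b_but_a2 l (Z M R : seq (seq cint)) :=
  extend (l, Cb) (upto_a l Z R) M.
Definition upto_a2 l (Z R : seq (seq cint)) :=
  extend (l.+1, Ca2) (upto_a l Z R) R.
Definition upto_b l (Z M R : seq (seq cint)) :=
  extend (l, Cb) (upto_a2 l Z R) M.
Definition upto_odd_a l (Z M R : seq (seq cint)) :=
  extend (l.+1, Ca) (extend (l.+1, Cab) (upto_b l Z M R) M) Z.
Definition upto_odd_b l (Z M R : seq (seq cint)) :=
  extend (l.+1, Cb) (extend (l.+1, Cb2) (upto_odd_a l Z M R) M) (upto_a l Z R).
Definition upto_ab l (Z M R : seq (seq cint)) :=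
  extend (l.+2, Cab) (upto_odd_b l Z M R) (upto_b_but_a2 l Z M R).

(** One step goes from [l] to [l + 2], the period of the parity-dependent difference table, and
    needs only these three lists. The seed is [l = 2], where the parts up to [2_ab] are [1_a], [1_b]
    and [2_ab]. *)
Fixpoint level (j : nat) : seq (seq cint) * seq (seq cint) * seq (seq cint) :=
  if j is i.+1 then
    let: (Z, M, R) := level i in
    let l := i.+1.*2 in
    (upto_ab l Z M R, upto_odd_a l Z M R, upto_b_but_a2 l Z M R)
  else
    let M := extend (1, Ca) [:: [::]] [:: [::]] in
    (extend (2, Cab) (extend (1, Cb) M [:: [::]]) [:: [::]], M, [:: [::]]).

(* At [level j], the even integer [l] is [j.+1.*2]. *)
Definition levelZ j := (level j).1.1.
Definition levelM j := (level j).1.2.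
Definition levelR j := (level j).2.

Definition rank_le i : pred cint := fun y => rank y <= i.

Definition rank_le_but i e : pred cint := fun y => (rank y <= i) && (rank y != e).

Lemma part_okE k c :
  part_ok (k, c) =
  match c with
  | Ca | Cb => 0 < k
  | Cab => 1 < k
  | Ca2 | Cb2 => odd k && (1 < k)
  end.
Proof. by case: c; rewrite /part_ok /= !xpair_eqE /= ?andbT ?andbF; lia. Qed.

Ltac colour_cases :=
  try (let k := fresh "k" in let c := fresh "c" in
       intros [k c]; rewrite part_okE; destruct c);
  rewrite ?part_okE /rank_le /rank_le_but /rank /diff_ok /= ?xpair_eqE /=
    ?odd_double /= ?andbF ?andbT ?orbF ?orbT; lia.

(** For each new part, its row of the difference table, read through [rank], is exactly the head
    predicate of the second list given to [extend]; [colour_cases] checks this colour by colour. *)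
Lemma enumerates_level j (l := j.+1.*2) :
  [/\ enumerates (rank_le (4 * l)) (levelZ j),
      enumerates (rank_le (4 * l - 3)) (levelM j)
    & enumerates (rank_le_but (4 * l - 5) (4 * l - 6)) (levelR j)].
Proof.
rewrite /levelZ /levelM /levelR {}/l; elim: j => [|j] /=.
  have eM : enumerates (rank_le 5) (extend (1, Ca) [:: [::]] [:: [::]]).
    apply: (enumerates_extend enumerates_nil enumerates_nil) => //; colour_cases.
  (* The smallest part is [1_a], of rank 5, so only the empty sequence qualifies. *)
  have e0 : enumerates (rank_le_but 3 2) [:: [::]].
    split=> // -[|[k c] s] //; rewrite inE /= admissible_cons.
    case E: (part_ok _) => //=; move: E; rewrite part_okE.
    move=> okc; apply/esym/andP => -[_]; move: okc.
    by case: c; rewrite /rank_le_but /rank /=; lia.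
  have e1 : enumerates (rank_le 7)
      (extend (1, Cb) (extend (1, Ca) [:: [::]] [:: [::]]) [:: [::]]).
    apply: (enumerates_extend eM enumerates_nil) => //; colour_cases.
  split=> //.
  apply: (enumerates_extend e1 enumerates_nil) => //; colour_cases.
case: (level j) => -[Z M] R /= [eZ eM eR].
have eA : enumerates (rank_le (4 * j.+1.*2 + 1)) (upto_a j.+1.*2 Z R).
  apply: (enumerates_extend eZ eR) => //; colour_cases.
have eP : enumerates (rank_le_but (4 * j.+1.*2 + 3) (4 * j.+1.*2 + 2))
    (upto_b_but_a2 j.+1.*2 Z M R).
  apply: (enumerates_extend eA eM) => //; colour_cases.
have eA2 : enumerates (rank_le (4 * j.+1.*2 + 2)) (upto_a2 j.+1.*2 Z R).
  apply: (enumerates_extend eA eR) => //; colour_cases.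
have eB : enumerates (rank_le (4 * j.+1.*2 + 3)) (upto_b j.+1.*2 Z M R).
  apply: (enumerates_extend eA2 eM) => //; colour_cases.
have eX1 : enumerates (rank_le (4 * j.+1.*2 + 4))
    (extend (j.+1.*2.+1, Cab) (upto_b j.+1.*2 Z M R) M).
  apply: (enumerates_extend eB eM) => //; colour_cases.
have eX2 : enumerates (rank_le (4 * j.+1.*2 + 5)) (upto_odd_a j.+1.*2 Z M R).
  apply: (enumerates_extend eX1 eZ) => //; colour_cases.
have eX3 : enumerates (rank_le (4 * j.+1.*2 + 6))
    (extend (j.+1.*2.+1, Cb2) (upto_odd_a j.+1.*2 Z M R) M).
  apply: (enumerates_extend eX2 eM) => //; colour_cases.
have eX4 : enumerates (rank_le (4 * j.+1.*2 + 7)) (upto_odd_b j.+1.*2 Z M R).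
  apply: (enumerates_extend eX3 eA) => //; colour_cases.
have -> : 4 * j.+2.*2 - 3 = 4 * j.+1.*2 + 5 by lia.
have -> : 4 * j.+2.*2 - 5 = 4 * j.+1.*2 + 3 by lia.
have -> : 4 * j.+2.*2 - 6 = 4 * j.+1.*2 + 2 by lia.
have -> : 4 * j.+2.*2 = 4 * j.+1.*2 + 8 by lia.
split=> //.
apply: (enumerates_extend eX4 eP) => //; colour_cases.
Qed.

(** * Recurrences and shift identities for the generating functions *)

Section GeneratingFunction.
Variable R : comNzRingType.
Implicit Types a b q d x y : R.
Local Open Scope ring_scope.

Definition monom a b q (s : seq cint) : R :=
  a ^+ weight_u s * b ^+ weight_v s * q ^+ psize s.

Definition gf a b q (L : seq (seq cint)) : R := \sum_(s <- L) monom a b q s.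

Lemma monom_cons a b q c s :
  monom a b q (c :: s) = monom a b q [:: c] * monom a b q s.
Proof.
rewrite /monom /weight_u /weight_v /psize /= !addn0 !mulnDr !exprD; ring.
Qed.

Lemma gf_extend a b q c L1 L2 :
  gf a b q (extend c L1 L2) = gf a b q L1 + monom a b q [:: c] * gf a b q L2.
Proof.
rewrite /gf /extend big_cat big_map mulr_sumr; congr (_ + _).
by apply: eq_bigr => s _; rewrite monom_cons.
Qed.

Lemma gf_nil a b q : gf a b q [:: [::]] = 1.
Proof. by rewrite /gf big_seq1 /monom !expr0 !mulr1. Qed.

Lemma monom1 a b q k c : monom a b q [:: (k, c)] =
  match c with
  | Ca => a | Cb => b | Cab => a * b | Ca2 => a ^+ 2 | Cb2 => b ^+ 2
  end * q ^+ k.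
Proof.
by case: c; rewrite /monom /weight_u /weight_v /psize /= ?muln0 ?muln1 ?addn0
  ?add0n ?expr0 ?expr1 ?mul1r ?mulr1.
Qed.

Definition gZ a b q j := gf a b q (levelZ j).
Definition gM a b q j := gf a b q (levelM j).
Definition gR a b q j := gf a b q (levelR j).

Lemma levelS j :
  [/\ levelZ j.+1 = upto_ab j.+1.*2 (levelZ j) (levelM j) (levelR j),
      levelM j.+1 = upto_odd_a j.+1.*2 (levelZ j) (levelM j) (levelR j)
    & levelR j.+1 = upto_b_but_a2 j.+1.*2 (levelZ j) (levelM j) (levelR j)].
Proof. by rewrite /levelZ /levelM /levelR /=; case: (level j) => -[]. Qed.

Lemma gRS a b q j :
  gR a b q j.+1 = gZ a b q j + a * q ^+ j.+1.*2 * gR a b q j + b * q ^+ j.+1.*2 * gM a b q j.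
Proof. by have [_ _ E] := levelS j; rewrite /gR E !gf_extend !monom1. Qed.

Lemma gMS a b q j :
  gM a b q j.+1 =
  gR a b q j.+1 + a ^+ 2 * q ^+ j.+1.*2.+1 * gR a b q j
  + a * b * q ^+ j.+1.*2.+1 * gM a b q j + a * q ^+ j.+1.*2.+1 * gZ a b q j.
Proof.
have [_ E F] := levelS j.
by rewrite /gM /gR /gZ E F !gf_extend !monom1; ring.
Qed.

Lemma gZS a b q j :
  gZ a b q j.+1 =
  gM a b q j.+1 + b ^+ 2 * q ^+ j.+1.*2.+1 * gM a b q j
  + b * q ^+ j.+1.*2.+1 * (gZ a b q j + a * q ^+ j.+1.*2 * gR a b q j)
  + a * b * q ^+ j.+1.*2.+2 * gR a b q j.+1.
Proof.
have [E F G] := levelS j.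
by rewrite /gZ /gM /gR E F G !gf_extend !monom1.
Qed.

Lemma g0 a b q :
  [/\ gR a b q 0 = 1, gM a b q 0 = 1 + a * q
    & gZ a b q 0 = (1 + a * q) * (1 + b * q)].
Proof.
rewrite /gZ /gM /gR /levelZ /levelM /levelR /= !gf_extend !gf_nil !monom1.
by split=> //; ring.
Qed.

(* The last two identities serve to close the induction. *)
Lemma g_shift a b q j (a' := b) (b' := a * q) :
  [/\ gZ a b q j = (1 + a * q) * gM a' b' q j,
      gM a b q j = (1 + a * q) * gR a' b' q j,
      gR a b q j.+1 = gZ a' b' q j + a' * q ^+ j.+1.*2 * gR a' b' q j
                      + a * q * gM a' b' q j
    & gZ a' b' q j = gM a' b' q j + a * q ^+ j.+1.*2 * gR a b q j
                     + a * b * q ^+ j.+1.*2.+1 * gR a' b' q j].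
Proof.
rewrite {}/a' {}/b'.
elim: j => [|j [eZ eM eP eZ']].
  have [r m z] := g0 a b q; have [r' m' z'] := g0 b (a * q) q.
  by rewrite gRS r m z r' m' z' /=; split; ring.
move: (gRS a b q j) (gRS b (a * q) q j) (gMS a b q j) (gMS b (a * q) q j).
move: (gZS a b q j) (gZS b (a * q) q j) (gRS a b q j.+1).
rewrite [j.+2.*2]doubleS; move: eP eZ'.
(* With [q ^+ l] replaced by a variable, what remains are polynomial identities. *)
move: j.+1.*2 => l; rewrite !(exprS q).
move: (q ^+ l) => x eP eZ' gZ1 gZ1' gR2 gR1 gR1' gM1 gM1'.
have eM1 : gM a b q j.+1 = (1 + a * q) * gR b (a * q) q j.+1.
  by rewrite gM1 gR1 gR1' eZ eM eZ'; ring.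
(* This combination occurs in [gZ1]; it is traded for [gR a b q j.+1] and [gM a b q j], whose
   shifted forms are [eP] and [eM]. *)
have eA : gZ a b q j + a * x * gR a b q j = gR a b q j.+1 - b * x * gM a b q j.
  by rewrite gR1; ring.
have eZ1 : gZ a b q j.+1 = (1 + a * q) * gM b (a * q) q j.+1.
  by rewrite gZ1 eA eM1 gM1' eP eM; ring.
have eZ1' : gZ b (a * q) q j.+1 = gM b (a * q) q j.+1
    + a * (q * (q * x)) * gR a b q j.+1
    + a * b * (q * (q * (q * x))) * gR b (a * q) q j.+1.
  by rewrite gZ1' eP; ring.
by split=> //; rewrite gR2 eZ1 eM1 eZ1'; ring.
Qed.

End GeneratingFunction.

(** * Passage to the product modulo powers of [q] *)

Section Congruence.
Variable R : comNzRingType.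
Implicit Types a b q d x y : R.
Local Open Scope ring_scope.

Definition eqmod d x y := exists r, x = y + d * r.

Lemma eqmod_trans d x y z : eqmod d x y -> eqmod d y z -> eqmod d x z.
Proof. by move=> [r ->] [s ->]; exists (r + s); ring. Qed.

Lemma eqmod_mull d z x y : eqmod d x y -> eqmod d (z * x) (z * y).
Proof. by move=> [r ->]; exists (z * r); ring. Qed.

Lemma eqmod_dvd d e x y : eqmod (d * e) x y -> eqmod d x y.
Proof. by move=> [r ->]; exists (e * r); ring. Qed.

Lemma monom_dvd a b q d k c : (0 < k)%N ->
    (exists r, a * q = d * r) -> (exists r, b * q = d * r) ->
  exists r, monom a b q [:: (k, c)] = d * r.
Proof.
case: k => // k _ [r ar] [s bs]; rewrite monom1 (exprS q).
case: c; rewrite ?expr2 mulrA.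
- by exists (r * q ^+ k); rewrite ar; ring.
- by exists (s * q ^+ k); rewrite bs; ring.
- by exists (a * s * q ^+ k); rewrite -[a * b * q]mulrA bs; ring.
- by exists (a * r * q ^+ k); rewrite -[a * a * q]mulrA ar; ring.
- by exists (b * s * q ^+ k); rewrite -[b * b * q]mulrA bs; ring.
Qed.

Lemma eqmod1_extend a b q d k c L1 L2 : (0 < k)%N ->
    (exists r, a * q = d * r) -> (exists r, b * q = d * r) ->
    eqmod d (gf a b q L1) 1 ->
  eqmod d (gf a b q (extend (k, c) L1 L2)) 1.
Proof.
move=> k0 ar bs [t eL]; have [r er] := monom_dvd c k0 ar bs.
by exists (t + r * gf a b q L2); rewrite gf_extend eL er; ring.
Qed.

(** Every nonempty sequence has a monomial divisible by [a * q] or [b * q], so only the empty one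
    survives modulo [d]. *)
Lemma gZ_eqmod1 a b q d j :
    (exists r, a * q = d * r) -> (exists r, b * q = d * r) ->
  eqmod d (gZ a b q j) 1.
Proof.
move=> ar bs; rewrite /gZ; elim: j => [|j IH].
  do 3!apply: eqmod1_extend => //; exists 0; rewrite gf_nil; ring.
(* One application for each of the eight coloured integers from [l_a] to [(l+2)_ab]. *)
have [-> _ _] := levelS j; do 8!apply: eqmod1_extend => //.
Qed.

(** Two shifts extract [(1 + a * q) * (1 + b * q)] and return the variables to their places, leaving
    [gR] at level [c + i.+1]. By [gRS] this is [gZ] one level lower plus multiples of
    [q ^+ (c + i).+1.*2], so each pair of factors costs one level. *)
Lemma gZ_eqmod_prod a b q c i :
  eqmod (q ^+ c.+1.*2) (gZ a b q (c + i))
    ((\prod_(1 <= k < i.+1) ((1 + a * q ^+ k) * (1 + b * q ^+ k)))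
     * gZ (a * q ^+ i) (b * q ^+ i) q c).
Proof.
elim: i a b => [|i IH] a b.
  by rewrite addn0 big_geq // expr0 !mulr1 mul1r; exists 0; ring.
have [-> _ _ _] := g_shift a b q (c + i.+1).
have [_ -> _ _] := g_shift b (a * q) q (c + i.+1).
rewrite big_ltn // big_add1 /= expr1 mulrA -[X in eqmod _ _ X]mulrA.
apply: eqmod_mull.
apply: (@eqmod_trans _ _ (gZ (a * q) (b * q) q (c + i))).
  exists (q ^+ i.*2 * (a * q * gR (a * q) (b * q) q (c + i)
                       + b * q * gM (a * q) (b * q) q (c + i))).
  by rewrite addnS gRS -addSn doubleD exprD; ring.
have := IH (a * q) (b * q); rewrite !exprS -!mulrA.
congr (eqmod _ _ (_ * _)); apply: eq_bigr => k _.
by rewrite exprS !mulrA.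
Qed.

(** Extracting the product takes [N] levels; the other [N] keep the modulus high enough. The
    remaining [gZ] has variables [a * q ^+ N] and [b * q ^+ N], hence is 1 modulo [q ^+ N.+1]. *)
Lemma gZ_eqmod_truncated_prod a b q N :
  eqmod (q ^+ N.+1) (gZ a b q (N + N))
    (\prod_(1 <= k < N.+1) ((1 + a * q ^+ k) * (1 + b * q ^+ k))).
Proof.
apply: eqmod_trans (eqmod_dvd (e := q ^+ N.+1) _) _.
  rewrite -exprD addnn; exact: gZ_eqmod_prod.
rewrite -[X in eqmod _ _ X]mulr1; apply: eqmod_mull; apply: gZ_eqmod1.
  by exists a; rewrite exprSr; ring.
by exists b; rewrite exprSr; ring.
Qed.

End Congruence.

(** * Reading off coefficients *)

Section Coefficients.
Local Open Scope ring_scope.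
Notation X i := ('X_(i : 'I_3) : {mpoly int[3]}).

Lemma mcoeff_eqmod (x y : {mpoly int[3]}) u v n e : (n < e)%N ->
  eqmod (X 2 ^+ e) x y -> x@_(mono u v n) = y@_(mono u v n).
Proof.
move=> ne [r ->]; rewrite mcoeffD mpolyXn mcoeffM big1 ?addr0 // => k /eqP E.
rewrite mcoeffX; case: eqP => [ek|_]; last by rewrite mul0r.
have /= := congr1 (fun m : 'X_{1..3} => m (2 : 'I_3)) E.
rewrite mnmDE -ek mulmnE mnm1E eqxx mul1n mnm_tnth /mono /= => En.
by have : (e <= n)%N; [rewrite [n](En : n = _) leq_addr | rewrite leqNgt ne].
Qed.

Lemma monomX s :
  monom (X 0) (X 1) (X 2) s = 'X_[mono (weight_u s) (weight_v s) (psize s)].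
Proof.
rewrite /monom [RHS]mpolyXE_id !big_ord_recl big_ord0 mulr1 mulrA !mnm_tnth /=.
by do ![congr (_ * _)]; congr ('X_ _ ^+ _); apply: val_inj.
Qed.

Lemma mono_eq u v n u' v' n' :
  (mono u v n == mono u' v' n') = [&& n == n', u == u' & v == v'].
Proof.
apply/eqP/and3P => [E|[/eqP -> /eqP -> /eqP ->]//].
have := congr1 (fun m : 'X_{1..3} => (m (0 : 'I_3), m (1 : 'I_3), m (2 : 'I_3))) E.
rewrite !mnm_tnth => -[eu ev en].
by split; apply/eqP; [exact: en | exact: eu | exact: ev].
Qed.

Lemma mcoeff_gf u v n L :
  (gf (X 0) (X 1) (X 2) L)@_(mono u v n) =
  (count (fun s => [&& psize s == n, weight_u s == u & weight_v s == v]) L)%:R.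
Proof.
rewrite /gf raddf_sum -sum1_count natr_sum /= [RHS]big_mkcond /=.
apply: eq_bigr => s _; rewrite /= monomX mcoeffX mono_eq.
by case: ifP.
Qed.

End Coefficients.

(** * Comparing [D] with the enumerating lists, and conclusion *)

Lemma mem_seqs_upto (T : eqType) (xs : seq T) len s :
  (s \in seqs_upto xs len) = (size s <= len) && all (mem xs) s.
Proof.
elim: len s => [|l IH] [|x s] //=.
rewrite inE /=; apply/allpairsP/idP => [[[y t] /= [yx tl [-> ->]]]|].
  by rewrite yx; rewrite IH in tl.
by case/and3P => sl xx sx; exists (x, s); split; rewrite // IH ltnS in sl *; apply/andP.
Qed.

Lemma mem_cints_upto n k c : ((k, c) \in cints_upto n) = (0 < k <= n).
Proof.
apply/allpairsP/idP => [[[i d] /= [+ _ [-> _]]]|kn].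
  by rewrite mem_iota; lia.
exists (k, c); split=> //=; first by rewrite mem_iota; lia.
by case: (c).
Qed.

Lemma part_ok_gt0 k c : part_ok (k, c) -> 0 < k.
Proof. by rewrite part_okE; case: c; lia. Qed.

Lemma all_part_le s : all part_ok s ->
  (size s <= psize s) && all (mem (cints_upto (psize s))) s.
Proof.
elim: s => //= -[k c] s IH /andP[/part_ok_gt0 k0 /IH /andP[ss sa]].
rewrite /psize /= -/(psize s); apply/and3P; split.
- by lia.
- by rewrite /= mem_cints_upto; lia.
apply: sub_all sa => -[i d]; rewrite /= !mem_cints_upto; lia.
Qed.

(** In a sequence of size [n] the first part has value at most [n], hence rank at most [4 * n + 3],
    below the bound [4 * J.+1.*2] on heads in [levelZ J]. So the bound excludes nothing, and two
    duplicate-free lists with the same members are compared. *)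
Lemma D_level u v n J : n <= J ->
  D u v n = count (fun s => [&& psize s == n, weight_u s == u & weight_v s == v])
                  (levelZ J).
Proof.
move=> nJ; rewrite /D -!size_filter; apply/perm_size/uniq_perm.
- exact/filter_uniq/undup_uniq.
- by apply: filter_uniq; have [[]] := enumerates_level J.
move=> s; rewrite !mem_filter mem_undup mem_seqs_upto.
have [[_ -> _ _]] := enumerates_level J.
case ads: (admissible s); rewrite ?andbF //=.
case: eqP => //= sn; do 2!case: eqP => //= _.
have /andP[aps _] := ads; have := all_part_le aps; rewrite sn => -[-> /=].
case: s ads aps sn => //= -[k c] s _ _; rewrite /psize /= /rank_le /rank /=.
by case: c => /=; lia.
Qed.

(* Equality of formal power series in a, b, q: the coefficient of
   a^u b^v q^n of the infinite product is that of any truncation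
   prod_{k=1}^{N} with N >= n (factors with k > n contribute only
   q-degree > n). *)
Theorem theorem1p7 (u v n N : nat) :
  (n <= N)%N -> ((prodN N)@_(mono u v n) = (D u v n)%:R :> int)%R.
Proof.
move=> nN; rewrite (@D_level _ _ _ (N + N)) ?(leq_trans nN) ?leq_addr //.
rewrite -mcoeff_gf; apply/esym/(@mcoeff_eqmod _ _ _ _ _ N.+1) => //.
exact: gZ_eqmod_truncated_prod.
Qed.
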